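(* Let $\mathsf{Op}_\alpha$ be a vector space over a field $k$, let $A_\alpha\subseteq\mathrm{End}_k(\mathsf{Op}_\alpha)$ be a unital subalgebra, regarded as acting on $\mathsf{Op}_\alpha$ from the left, and let $G_0\subseteq\mathsf{Op}_\alpha$ be a subset. Let $\langle G_0\rangle_{A_\alpha}:=A_\alpha\cdot G_0$ be the $A_\alpha$-closure of $G_0$. Then $\langle G_0\rangle_{A_\alpha}$ is the unique minimal left $A_\alpha$-stable submodule of $\mathsf{Op}_\alpha$ containing $G_0$. In particular, any left $A_\alpha$-submodule $M\subseteq\mathsf{Op}_\alpha$ containing $G_0$ satisfies $\langle G_0\rangle_{A_\alpha}\subseteq M$.
   Context: In the source, $\mathsf{Op}_\alpha$ is a truncated span of gauge-invariant local operators carrying a representation of a symmetry group $G$, and $A_\alpha$ (the ''interface algebra'') is the algebra of admissible symmetry-preserving endomorphisms of $\mathsf{Op}_\alpha$, e.g. $A_\alpha=\mathrm{End}_G(\mathsf{Op}_\alpha)$. Only the fact that $A_\alpha$ is a unital algebra acting linearly on $\mathsf{Op}_\alpha$ is relevant here. The notation $A_\alpha\cdot G_0$ means the $k$-linear span of $\{a\cdot g: a\in A_\alpha,\ g\in G_0\}$. ''Unique minimal'' means the least element, with respect to inclusion, among left $A_\alpha$-submodules of $\mathsf{Op}_\alpha$ containing $G_0$. *)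

(* Defs.v *)
From mathcomp Require Import all_boot all_algebra.
From mathcomp Require Import boolp classical_sets.
Set Implicit Arguments.
Unset Strict Implicit.
Unset Printing Implicit Defensive.
Import GRing.Theory.
Local Open Scope classical_set_scope.
Local Open Scope ring_scope.

(* V may be infinite-dimensional, so End_k(V) is the type {linear V -> V},
   with pointwise addition and scaling and composition as product. It is not
   an algType (V = 0 would give the zero ring), hence the closure conditions
   are stated directly; 0 and opposites come from scaling by 0 and -1. *)
Record unital_subalgebra (k : fieldType) (V : lmodType k)
    (A : set {linear V -> V}) : Prop := UnitalSubalgebra {
  usub_id : A idfun;
  usub_add : forall f g : {linear V -> V}, A f -> A g -> A (f \+ g);
  usub_scale : forall (c : k) (f : {linear V -> V}), A f -> A (c \*: f);
  usub_comp : forall f g : {linear V -> V}, A f -> A g -> A (f \o g)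
}.

(* As for modules over any ring, only an additive subgroup is required:
   k-stability follows when A is a unital subalgebra, as c *: idfun is in A. *)
Definition left_submodule (k : fieldType) (V : lmodType k)
    (A : set {linear V -> V}) (M : set V) : Prop :=
  GRing.zmod_closed [in M] /\
  forall (a : {linear V -> V}) (m : V), A a -> M m -> M (a m).

Definition linear_span (k : fieldType) (V : lmodType k) (S : set V) : set V :=
  [set v | exists (n : nat) (c : 'I_n -> k) (s : 'I_n -> V),
    (forall i, S (s i)) /\ v = \sum_(i < n) c i *: s i].

Definition algebra_closure (k : fieldType) (V : lmodType k)
    (A : set {linear V -> V}) (G0 : set V) : set V :=
  linear_span [set v | exists a : {linear V -> V}, exists g : V,
    [/\ A a, G0 g & v = a g]].

Definition is_least (T : Type) (C : set (set T)) (N : set T) : Prop :=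
  C N /\ forall M : set T, C M -> N `<=` M.

(* Main.v *)
Require Import Defs.
From mathcomp Require Import all_boot all_algebra.
From mathcomp Require Import boolp classical_sets.
Local Open Scope classical_set_scope.
Local Open Scope ring_scope.

Import GRing.Theory.

(** The span of the products [a g] is an additive subgroup. It is stable under [A] because
    [a (b g) = (a \o b) g] sends generators to generators ([algebra_closure_left_submodule]), and it
    contains [G0] because [g = idfun g] ([sub_algebra_closure]). Conversely, a submodule containing
    [G0] contains every term of such a combination, hence the sum ([algebra_closure_min]). *)

Lemma sub_linear_span (k : fieldType) (V : lmodType k) (S : set V) :
  S `<=` linear_span S.
Proof.
move=> v Sv; exists 1%N, (fun=> 1), (fun=> v); split=> //.
by rewrite big_ord1 scale1r.
Qed.

Lemma linear_spanB (k : fieldType) (V : lmodType k) (S : set V) (u v : V) :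
  linear_span S u -> linear_span S v -> linear_span S (u - v).
Proof.
move=> [m [c [s [Ss ->]]]] [n [d [t [St ->]]]].
(* The two families are concatenated, the second with negated coefficients; [split] tells which
   block an index lies in. *)
exists (m + n)%N,
  (fun i => match split i with inl j => c j | inr j => - d j end),
  (fun i => match split i with inl j => s j | inr j => t j end).
split=> [i|]; first by case: (split i).
rewrite big_split_ord /= -sumrN; congr (_ + _); apply: eq_bigr => i _.
  by rewrite (unsplitK (inl i)).
by rewrite (unsplitK (inr i)) scaleNr.
Qed.

Lemma linear_span_zmod_closed (k : fieldType) (V : lmodType k) (S : set V) :
  GRing.zmod_closed [in linear_span S].
Proof.
split=> [|u v]; rewrite !inE; last exact: linear_spanB.
by exists 0%N, (fun=> 0), (fun=> 0); split=> [[]|] //; rewrite big_ord0.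
Qed.

(** Linearity moves [f] inside the sum with the same coefficients, so stability need only be checked
    on generators. *)
Lemma linear_span_stable (k : fieldType) (V : lmodType k) (S : set V)
    (f : {linear V -> V}) (v : V) :
  (forall s, S s -> S (f s)) -> linear_span S v -> linear_span S (f v).
Proof.
move=> fS [n [c [s [Ss ->]]]]; exists n, c, (f \o s).
split=> [i|]; first exact/fS/Ss.
by rewrite linear_sum; apply: eq_bigr => i _; rewrite linearZ.
Qed.

Lemma algebra_closure_left_submodule (k : fieldType) (V : lmodType k)
    (A : set {linear V -> V}) (G0 : set V) :
  unital_subalgebra A -> left_submodule A (algebra_closure A G0).
Proof.
move=> hA; split; first exact: linear_span_zmod_closed.
move=> a m Aa; apply: linear_span_stable => _ [b [g [Ab Gg ->]]].
by exists (a \o b), g; split=> //; exact: usub_comp.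
Qed.

Lemma sub_algebra_closure (k : fieldType) (V : lmodType k)
    (A : set {linear V -> V}) (G0 : set V) :
  unital_subalgebra A -> G0 `<=` algebra_closure A G0.
Proof.
move=> hA g Gg; apply: sub_linear_span.
by exists idfun, g; split=> //; exact: usub_id.
Qed.

(* Scalars are absorbed into the algebra: c *: a g = (c \*: a) g, so additive
   closure of M suffices. *)
Lemma algebra_closure_min (k : fieldType) (V : lmodType k)
    (A : set {linear V -> V}) (G0 M : set V) :
  unital_subalgebra A -> left_submodule A M -> G0 `<=` M ->
  algebra_closure A G0 `<=` M.
Proof.
move=> hA [Mzmod Mstable] G0M _ [n [c [s [Ss ->]]]].
(* Closure under differences yields closure under sums, which the induction over the terms uses. *)
have [M0 MD] := GRing.zmod_closedD Mzmod.
apply: set_mem; apply: (big_ind (fun v => v \in M)) => // i _.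
have [a [g [Aa Gg ->]]] := Ss i; apply: mem_set.
by apply: (Mstable (c i \*: a) g); [exact: usub_scale|exact: G0M].
Qed.

Theorem proposition6p4 (k : fieldType) (Op : lmodType k)
    (A : set {linear Op -> Op}) (hA : unital_subalgebra A) (G0 : set Op) :
  is_least [set M : set Op | left_submodule A M /\ G0 `<=` M]
    (algebra_closure A G0) /\
  (forall M : set Op, left_submodule A M -> G0 `<=` M ->
    algebra_closure A G0 `<=` M).
Proof.
have min M : left_submodule A M -> G0 `<=` M -> algebra_closure A G0 `<=` M.
  exact: algebra_closure_min.
split=> //; split; last by move=> M []; exact: min.
by split; [exact: algebra_closure_left_submodule|exact: sub_algebra_closure].
Qed.
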